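(* For all natural numbers $r$, $k$, $l$ there are natural numbers $n=n(r,k,l)$ and $m=m(r,k,l)$ such that the following holds. Let $G$ be any abelian group (written additively) and let $A\subseteq G$ have an $(r,k,l)$-weakly normal representation. Then there are subgroups $H_1,\ldots,H_n$ of $G$, each contained in $A-A$, and elements $g_1,\ldots,g_n\in A$ such that \[A\subseteq \bigcup_{i=1}^{n}(g_i+H_i).\] Furthermore, each $H_i$ is a boolean combination of at most $m$ translates of $A$, i.e. there are $h_1,\ldots,h_m\in G$ such that $H_i$ belongs to the Boolean algebra of subsets of $G$ generated by $h_1+A,\ldots,h_m+A$. In particular, if $A$ is finite, then $|A\cap(g+H)|\geq |A|/n$ for some $g\in A$ and some subgroup $H\leqslant G$ contained in $A-A$.
   Context: Let $G$ be an abelian group. A subset $B\subseteq G$ is called $r$-weakly normal if the relation $B(x+y)$ is $r$-weakly normal, i.e. whenever $b_1,\ldots,b_r\in G$ are such that the sets $B-b_1,\ldots,B-b_r$ (where $B-b=\{x\in G: x+b\in B\}$) are pairwise distinct, then $\bigcap_{i=1}^r (B-b_i)=\emptyset$. A subset $A\subseteq G$ has an $(r,k,l)$-weakly normal representation if \[A=\bigcup_{j=1}^k B_j\ \cap\ \bigcup_{i=1}^l (G\setminus C_i)\] for some $r$-weakly normal subsets $B_1,\ldots,B_k,C_1,\ldots,C_l$ of $G$. $A-A=\{a-a':a,a'\in A\}$.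
   Formalization: The set A is assumed nonempty: for empty A no elements g_i of A exist and A−A contains no subgroup, so the statement as printed fails in that case. *)

(* Defs.v *)
From mathcomp Require Export all_boot all_order all_algebra finmap.
From mathcomp Require Export all_classical.

Set Implicit Arguments.
Unset Strict Implicit.
Unset Printing Implicit Defensive.

Import GRing.Theory.

Local Open Scope classical_set_scope.
Local Open Scope ring_scope.

Definition subgroup (G : zmodType) (H : set G) : Prop := zmod_closed [in H].

Definition translate (G : zmodType) (g : G) (A : set G) : set G :=
  [set g + x | x in A].

Definition difference_set (G : zmodType) (A : set G) : set G :=
  [set x - y | x in A & y in A].

(* The set B - b. *)
Definition shift (G : zmodType) (B : set G) (b : G) : set G :=
  [set x | B (x + b)].

(* For r = 0 the empty intersection is the whole group, so that no set is
   0-weakly normal. *)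
Definition weakly_normal (r : nat) (G : zmodType) (B : set G) : Prop :=
  forall b : 'I_r -> G,
    (forall i j : 'I_r, i <> j -> shift B (b i) <> shift B (b j)) ->
    \bigcap_(i in [set: 'I_r]) shift B (b i) = set0.

Definition weakly_normal_representation
    (r k l : nat) (G : zmodType) (A : set G) : Prop :=
  exists (B : 'I_k -> set G) (C : 'I_l -> set G),
    [/\ forall j, weakly_normal r (B j),
        forall i, weakly_normal r (C i) &
        A = (\bigcup_(j in [set: 'I_k]) B j) `&`
            (\bigcup_(i in [set: 'I_l]) ~` C i)].

Definition boolean_algebra (T : Type) (F : set_system T) : Prop :=
  [/\ F setT, (forall X : set T, F X -> F (~` X)),
      setU_closed F & setI_closed F].

Definition generated_algebra (T : Type) (S : set_system T) : set_system T :=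
  smallest (@boolean_algebra T) S.

(* Main.v *)
(* A subset B is r-weakly normal exactly when it is a union of fewer than r
   cosets of its group of periods: the translates B - b with b in B all contain
   0.  Hence A = (P_1 u ... u P_k) \ Q, where P_v is a union of boundedly many
   cosets of a subgroup S_v, and Q is a union of boundedly many cosets of a
   subgroup T.

   If S_v is virtually contained in T, replace it by its intersection with T; if
   S_v and S_w are commensurable, replace both by their intersection.  When
   neither is possible, choose S = S_v that is not virtually contained in any
   other S_w.  The part E of A made of cosets of S then agrees with A up to
   finitely many cosets of subgroups of large index in S, which by Neumann's
   lemma are escaped by generic translations in S.  So E is an intersection of
   unions of translates of A, its stabilizer H is an intersection of translates
   of E contained in A - A, and E is a union of boundedly many cosets of H.
   Continue with A \ E, which involves one subgroup fewer.  Here "virtually" and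
   "commensurable" refer to explicit index bounds, so that all numbers depend
   only on r, k and l. *)
Require Import Defs.

Set Implicit Arguments.
Unset Strict Implicit.
Unset Printing Implicit Defensive.

Import GRing.Theory Num.Theory.

Local Open Scope classical_set_scope.
Local Open Scope ring_scope.

(** * Subgroups, and covers by boundedly many translates *)

Lemma subgroupP (G : zmodType) (H : set G) :
  subgroup H <-> H 0 /\ forall x y, H x -> H y -> H (x - y).
Proof.
split=> -[H0 HB]; split.
- by move: H0; rewrite inE.
- by move=> x y Hx Hy; have := HB x y; rewrite !inE; apply.
- by rewrite inE.
- by move=> x y; rewrite !inE; apply: HB.
Qed.

Section Subgroups.
Variables (G : zmodType) (H : set G).
Hypothesis sgH : subgroup H.

Lemma subgroup0 : H 0. Proof. by have /subgroupP[] := sgH. Qed.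

Lemma subgroupB x y : H x -> H y -> H (x - y).
Proof. by have /subgroupP[_] := sgH; apply. Qed.

Lemma subgroupN x : H x -> H (- x).
Proof. by move=> Hx; rewrite -sub0r; apply: subgroupB => //; apply: subgroup0. Qed.

Lemma subgroupD x y : H x -> H y -> H (x + y).
Proof. by move=> Hx Hy; rewrite -[y]opprK; apply/subgroupB/subgroupN. Qed.

Lemma subgroup_diff a x y : H (x - a) -> H (y - a) -> H (x - y).
Proof. by move=> Hx Hy; have := subgroupB Hx Hy; rewrite opprB addrA addrNK. Qed.

End Subgroups.

Lemma subgroupI (G : zmodType) (H K : set G) :
  subgroup H -> subgroup K -> subgroup (H `&` K).
Proof.
move=> sgH sgK; apply/subgroupP; split; first by split; exact: subgroup0.
by move=> x y [Hx Kx] [Hy Ky]; split; exact: subgroupB.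
Qed.

Definition invariant (G : zmodType) (S X : set G) :=
  forall x s, X x -> S s -> X (x + s).

(* For subgroups T and S, [covered K T S] says that the index of S `&` T in S is
   at most K. *)
Definition covered (G : zmodType) (q : nat) (U X : set G) :=
  exists2 s : seq G, (size s <= q)%N &
    forall x, X x -> exists2 c, c \in s & U (x - c).

Lemma covered_leq (G : zmodType) q q' (U U' X X' : set G) :
  (q <= q')%N -> U `<=` U' -> X' `<=` X -> covered q U X -> covered q' U' X'.
Proof.
move=> qq' UU' XX' [s sq cX]; exists s; first exact: leq_trans qq'.
by move=> x /XX'/cX[c cs Uc]; exists c => //; exact: UU'.
Qed.

Lemma covered_self (G : zmodType) (S : set G) : covered 1 S S.
Proof. by exists [:: 0] => // x Sx; exists 0; rewrite ?mem_head ?subr0. Qed.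

Lemma coveredU (G : zmodType) q1 q2 (U X Y : set G) :
  covered q1 U X -> covered q2 U Y -> covered (q1 + q2) U (X `|` Y).
Proof.
move=> [s sq cX] [t tq cY]; exists (s ++ t); first by rewrite size_cat leq_add.
by move=> x [/cX|/cY] [c cs Uc]; exists c; rewrite // mem_cat cs ?orbT.
Qed.

Lemma covered_bigcup (G : zmodType) (I : finType) (A : {set I}) q
    (U : set G) (X : I -> set G) :
    (forall i, i \in A -> covered q U (X i)) ->
  covered (#|A| * q) U (\bigcup_(i in [set` A]) X i).
Proof.
move=> cX; have /choice[s sP] : forall i, exists s : seq G, i \in A ->
    (size s <= q)%N /\ forall x, X i x -> exists2 c, c \in s & U (x - c).
  move=> i; case: (boolP (i \in A)) => iA; last by exists [::].
  by have [s ? ?] := cX i iA; exists s.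
exists (flatten [seq s i | i <- enum A]).
  rewrite size_flatten /shape -map_comp sumnE big_map big_enum /=.
  by rewrite -sum_nat_const; apply: leq_sum => i /sP[].
move=> x [i iA /(proj2 (sP i iA))[c cs Uc]]; exists c => //.
by apply/flatten_mapP; exists i; rewrite // mem_enum.
Qed.

Lemma covered_trans (G : zmodType) q K (S T X : set G) :
  covered q S X -> covered K T S -> covered (q * K) T X.
Proof.
move=> [s sq cX] [t tK cS]; exists [seq c + d | c <- s, d <- t].
  by rewrite size_allpairs leq_mul.
move=> x /cX[c cs /cS[d dt Td]]; exists (c + d); first exact: allpairs_f.
by rewrite opprD addrA.
Qed.

(** Choosing one point of [X] in each class that meets [X] keeps the centres inside [X]. *)
Lemma covered_classes (G : zmodType) (I : finType) (V : I -> set G)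
    (U X : set G) :
    (forall x, X x -> exists i, V i x) ->
    (forall i x y, X x -> X y -> V i x -> V i y -> U (x - y)) ->
  exists s : seq G, [/\ (size s <= #|I|)%N, forall c, c \in s -> X c &
    forall x, X x -> exists2 c, c \in s & U (x - c)].
Proof.
move=> XV VU; pose P i y := X y /\ V i y.
have /choice[f fP] : forall i, exists y, (exists z, P i z) -> P i y.
  by move=> i; case: (pselect (exists z, P i z)) => [[z]|]; [exists z|exists 0].
exists [seq f i | i <- enum I & `[<exists z, P i z>]]; split.
- by rewrite size_map size_filter (leq_trans (count_size _ _)) // cardE.
- by move=> c /mapP[i]; rewrite mem_filter => /andP[/asboolP/fP[]] ? ? _ ->.
move=> x Xx; have [i Vx] := XV x Xx.
have Pi : exists z, P i z by exists x.
exists (f i); last by have [] := fP i Pi => *; exact: (VU i).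
by apply: map_f; rewrite mem_filter mem_enum andbT; exact/asboolP.
Qed.

Lemma covered_in (G : zmodType) q (U X : set G) :
    subgroup U -> covered q U X ->
  exists s : seq G, [/\ (size s <= q)%N, forall c, c \in s -> X c &
    forall x, X x -> exists2 c, c \in s & U (x - c)].
Proof.
move=> sgU [s sq cX].
have [||t [tq tX cX']] := @covered_classes G 'I_(size s)
    (fun i => [set x | U (x - s`_i)]) U X.
- by move=> x /cX[c /(nthP 0)[i ilt <-] Uc]; exists (Ordinal ilt).
- by move=> i x y _ _; exact: subgroup_diff.
by exists t; split=> //; rewrite (leq_trans tq) // card_ord.
Qed.

(** A class is given by one centre for each index, that is, by a function from [I] to ['I_q]. *)
Lemma covered_bigcap (G : zmodType) (I : finType) q (U X : I -> set G) :
    (forall i, subgroup (U i)) -> (forall i, covered q (U i) (X i)) ->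
  covered (q ^ #|I|) (\bigcap_i U i) (\bigcap_i X i).
Proof.
move=> sgU cX; have /choice[s sP] : forall i, exists s : seq G,
    (size s <= q)%N /\ forall x, X i x -> exists2 c, c \in s & U i (x - c).
  by move=> i; have [s ? ?] := cX i; exists s.
have [||t [tq _ cX']] := @covered_classes G {ffun I -> 'I_q}
    (fun h => [set x | forall i, U i (x - (s i)`_(h i))])
    (\bigcap_i U i) (\bigcap_i X i).
- move=> x Xx; have /choice[h hP] : forall i, exists j : 'I_q, U i (x - (s i)`_j).
    move=> i; have [sq /(_ x (Xx i Logic.I))] := sP i.
    move=> [c /(nthP 0)[j jlt <-] Uc].
    by exists (Ordinal (leq_trans jlt sq)).
  by exists (finfun h) => i; rewrite ffunE.
- by move=> h x y _ _ Ux Uy i _; exact: subgroup_diff (Ux i) (Uy i).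
by exists t; rewrite // (leq_trans tq) // card_ffun card_ord.
Qed.

Lemma coveredI (G : zmodType) q1 q2 (U V X Y : set G) :
    subgroup U -> subgroup V -> covered q1 U X -> covered q2 V Y ->
  covered (q1 * q2) (U `&` V) (X `&` Y).
Proof.
move=> sgU sgV [s sq cX] [t tq cY].
have [||w [wq _ cXY]] := @covered_classes G ('I_(size s) * 'I_(size t))%type
    (fun p => [set x | U (x - s`_p.1) /\ V (x - t`_p.2)])
    (U `&` V) (X `&` Y).
- move=> x [/cX[c /(nthP 0)[i ilt <-] Uc] /cY[d /(nthP 0)[j jlt <-] Vd]].
  by exists (Ordinal ilt, Ordinal jlt).
- by move=> p x y _ _ [Ux Vx] [Uy Vy]; split;
    [exact: (subgroup_diff sgU Ux Uy)|exact: (subgroup_diff sgV Vx Vy)].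
by exists w; rewrite // (leq_trans wq) // card_prod !card_ord leq_mul.
Qed.

(** * Neumann's lemma and generic translations *)

Lemma separated_seq (G : zmodType) t (U X : set G) :
    ~ covered t U X -> (forall x, U x -> U (- x)) ->
  exists s : 'I_t.+1 -> G, (forall i, X (s i)) /\
    forall i j, i <> j -> ~ U (s i - s j).
Proof.
move=> ncX UN.
suff [s [sz sX sU]] : exists s : seq G, [/\ size s = t.+1,
    forall c, c \in s -> X c & pairwise (fun x y => ~~ `[<U (y - x)>]) s].
  exists (fun i => s`_i); split=> [i|i j ij]; first by apply/sX/mem_nth; rewrite sz.
  have lt a b : (a < b)%N -> (b < t.+1)%N -> ~ U (s`_b - s`_a).
    move=> ab bt; apply/asboolPn.
    by move/(pairwiseP 0): sU => /(_ a b); apply; rewrite ?inE ?sz // (ltn_trans ab).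
  have [ltij|ltji|/ord_inj//] := ltngtP i j; last exact: lt.
  by move=> /UN; rewrite opprB; exact: lt.
(* The sequence grows one term at a time: if at most [t] terms admit no extension, they are the
   centres of a cover of [X]. *)
have : (t <= t)%N by [].
elim: {1 3}t => [_|u IHu ut].
  suff [x Xx] : exists x, X x.
    by exists [:: x]; split=> // c; rewrite inE => /eqP->.
  by apply: contra_notP ncX => nX; exists [::] => // x Xx; case: nX; exists x.
have [s [sz sX sU]] := IHu (ltnW ut).
have [x [Xx xs]] : exists x, X x /\ forall c, c \in s -> ~ U (x - c).
  apply: contra_notP ncX => nx; exists s; first by rewrite sz.
  move=> x Xx; apply: contra_notP nx => nx; exists x; split=> // c cs Uc.
  by case: nx; exists c.
exists (rcons s x); split; first by rewrite size_rcons sz.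
  by move=> c; rewrite mem_rcons inE => /orP[/eqP->|/sX].
rewrite pairwise_rcons sU andbT; apply/allP => c cs.
by apply/asboolPn/xs.
Qed.

Definition family_union (T : Type) (Rs : seq (set T)) : set T :=
  [set x | exists2 R, R \in Rs & R x].

(* B. H. Neumann's lemma, with a bound that depends only on the numbers of
   subgroups and of cosets. *)
Lemma neumann d q : exists K, forall (G : zmodType) (S : set G) Rs,
    subgroup S -> (forall R, R \in Rs -> subgroup R) -> (size Rs <= d)%N ->
    covered q (family_union Rs) S ->
  exists2 R, R \in Rs & covered K R S.
Proof.
elim: d q => [|d IHd] q.
  exists 0%N => G S [|//] sgS _ _ [s _ /(_ 0 (subgroup0 sgS))].
  by move=> [c _ []].
have [K KP] := IHd (q * q + q)%N; exists (maxn q K) => G S [|R Rs] sgS sgR.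
  by move=> _ [s _ /(_ 0 (subgroup0 sgS))] [c _ []].
rewrite ltnS => szR cS.
have sgR0 : subgroup R by apply: sgR; exact: mem_head.
have sgRs R' : R' \in Rs -> subgroup R' by move=> R'Rs; apply: sgR; rewrite inE R'Rs orbT.
case: (pselect (covered q R S)) => [cR|ncR].
  by exists R; [exact: mem_head|by apply: covered_leq cR; rewrite // leq_maxl].
suff [R' R'Rs cR'] : exists2 R', R' \in Rs & covered K R' S.
  exists R'; first by rewrite inE R'Rs orbT.
  by apply: covered_leq cR' => //; rewrite leq_maxr.
apply: KP => //; case: cS => s sq cS.
(* As [q] cosets of [R] do not cover [S], some [x] in [S] lies outside all those of the given
   cover. *)
have [x [Sx xs]] : exists x, S x /\ forall c, c \in s -> ~ R (x - c).
  apply: contra_notP ncR => nx; exists s => //.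
  move=> x Xx; apply: contra_notP nx => nx; exists x; split=> // c cs Uc.
  by case: nx; exists c.
(* The coset [x + R] avoids these cosets of [R], so its points in [S] lie in translates of the other
   subgroups; then subtract [x]. *)
have cRS : covered q (family_union Rs) (S `&` R).
  exists [seq c - x | c <- s]; first by rewrite size_map.
  move=> y [Sy Ry]; have [c cs [R']] := cS (x + y) (subgroupD sgS Sx Sy).
  have -> : x + y - c = y - (c - x) by rewrite opprB addrCA addrA.
  rewrite inE => /orP[/eqP->|R'Rs] R'c.
    case: (xs c cs); have := subgroupB sgR0 R'c Ry.
    by rewrite opprB addrAC subrr add0r.
  by exists (c - x); [exact: map_f|exists R'].
(* Within [S], each of the [q] cosets of [R] that meets [S] is a translate of the intersection of
   [S] and [R], and costs [q] translates of the union of the other subgroups. The last [q]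
   translates were there from the start. *)
have cSR : covered (q * q + q) (family_union Rs)
    (\bigcup_(c in [set c | c \in s]) [set z | S z /\ R (z - c)] `|`
     [set z | exists2 c, c \in s & family_union Rs (z - c)]).
  apply: coveredU; last by exists s.
  have /choice[f fP] : forall c, exists y, (exists z, S z /\ R (z - c)) ->
      S y /\ R (y - c).
    by move=> c; case: (pselect (exists z, S z /\ R (z - c)));
      [move=> [z]; exists z|exists 0].
  have cX : covered q (S `&` R) (\bigcup_(c in [set c | c \in s])
      [set z | S z /\ R (z - c)]).
    exists [seq f c | c <- s]; first by rewrite size_map.
    move=> z [c cs [Sz Rz]]; have [|Sf Rf] := fP c; first by exists z.
    exists (f c); first exact: map_f.
    by split; [exact: (subgroupB sgS)|exact: (subgroup_diff sgR0 Rz Rf)].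
  exact: covered_trans cX cRS.
apply: covered_leq cSR => // z Sz; have [c cs [R']] := cS z Sz.
rewrite inE => /orP[/eqP->|R'Rs] R'c; first by left; exists c.
by right; exists c => //; exists R'.
Qed.

Definition large (G : zmodType) K (S : set G) (Rs : seq (set G)) :=
  forall R, R \in Rs -> subgroup R /\ ~ covered K R S.

Lemma large_leq (G : zmodType) K K' (S : set G) Rs :
  (K <= K')%N -> large K' S Rs -> large K S Rs.
Proof.
move=> KK' lR R /lR[sgR nR]; split=> //; apply: contra_not nR.
exact: covered_leq.
Qed.

Lemma large_not_covered d q : exists K, forall (G : zmodType) (S : set G) Rs,
    subgroup S -> large K S Rs -> (size Rs <= d)%N ->
  ~ covered q (family_union Rs) S.
Proof.
have [K KP] := neumann d q; exists K => G S Rs sgS lR szR cS.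
have [R RRs] := KP G S Rs sgS (fun R RRs => (lR R RRs).1) szR cS.
by have [] := lR R RRs.
Qed.

Lemma family_unionN (G : zmodType) K (S : set G) Rs x :
  large K S Rs -> family_union Rs x -> family_union Rs (- x).
Proof. by move=> lR [R RRs Rx]; exists R => //; apply: subgroupN => //; have [] := lR R. Qed.

(** If all [x - s i] were in [W], two of these [t + 1] points would share a centre and a subgroup of
    [Rs], and [s i - s j] would lie in that subgroup. *)
Lemma escape (G : zmodType) t L Rs (W : set G) (s : 'I_t.+1 -> G) :
    (forall R, R \in Rs -> subgroup R) -> covered L (family_union Rs) W ->
    (L * size Rs <= t)%N ->
    (forall i j, i <> j -> ~ family_union Rs (s i - s j)) ->
  forall x, exists i, ~ W (x - s i).
Proof.
move=> sgR [w wL cW] Lt sU x; apply: contrapT => /forallNP nW.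
have /choice[f fP] : forall i, exists p : G * set G,
    [/\ p.1 \in w, p.2 \in Rs & p.2 (x - s i - p.1)].
  move=> i; have /contrapT/cW[c cw [R RRs Rc]] := nW i.
  by exists (c, R).
have /injectivePn[i [j /eqP ij fij]] : ~~ injectiveb f.
  apply/injectiveP => finj.
  have : (size (map f (enum 'I_t.+1)) <= size [seq (c, R) | c <- w, R <- Rs])%N.
    apply: uniq_leq_size; first by rewrite map_inj_uniq ?enum_uniq.
    move=> _ /mapP[i _ ->]; have [cw RRs _] := fP i.
    by rewrite [f i]surjective_pairing; exact: allpairs_f.
  rewrite size_map size_enum_ord size_allpairs; apply/negP; rewrite -ltnNge ltnS.
  by apply: leq_trans Lt; rewrite leq_mul.
apply: (sU i j ij); have [_ RRs Ri] := fP i; have [_ _ Rj] := fP j.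
exists (f i).2 => //; rewrite -fij in Rj.
have := subgroup_diff (sgR _ RRs) Rj Ri.
by rewrite opprB addrC addrA addrNK.
Qed.

(** * Boolean algebras generated by translates *)

Lemma translateE (G : zmodType) (g : G) (A : set G) :
  translate g A = [set x | A (x - g)].
Proof.
apply/seteqP; split=> [_ [x Ax <-]|x Ax]; first by rewrite /= addrAC subrr add0r.
by exists (x - g); rewrite // addrC subrK.
Qed.

Lemma translateD (G : zmodType) (g h : G) (A : set G) :
  translate g (translate h A) = translate (g + h) A.
Proof. by rewrite !translateE; apply/funext => x /=; rewrite opprD addrA. Qed.

Lemma boolean_algebra_generated (T : Type) (F : set_system T) :
  boolean_algebra (generated_algebra F).
Proof.
split.
- by move=> M [[]].
- by move=> X FX M MF; have [[_ MC _ _] _] := MF; apply: MC; exact: FX.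
- by move=> X Y FX FY M MF; have [[_ _ MU _] _] := MF; apply: MU; [exact: FX|exact: FY].
- by move=> X Y FX FY M MF; have [[_ _ _ MI] _] := MF; apply: MI; [exact: FX|exact: FY].
Qed.

Lemma generated_algebra_sub (T : Type) (F F' : set_system T) :
  F `<=` generated_algebra F' -> generated_algebra F `<=` generated_algebra F'.
Proof. exact: smallest_sub (boolean_algebra_generated F'). Qed.

(** Translation is a preimage and so commutes with Boolean operations: the sets whose translate by
    [g] lies in the target algebra form a Boolean algebra. *)
Lemma generated_algebra_translate (G : zmodType) (F F' : set_system G) g :
    (forall X, F X -> generated_algebra F' (translate g X)) ->
  forall X, generated_algebra F X -> generated_algebra F' (translate g X).
Proof.
move=> FF'; apply: (@smallest_sub _ _ _ [set X | generated_algebra F' (translate g X)]) => //.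
have [FT FC FU FI] := boolean_algebra_generated F'.
split=> [|X|X Y|X Y] /=; rewrite !translateE; [exact: FT|exact: FC|exact: FU|exact: FI].
Qed.

Definition in_algebra (G : zmodType) (m : nat) (A X : set G) :=
  exists2 h : seq G, (size h <= m)%N &
    generated_algebra [set translate g A | g in [set` h]] X.

Section InAlgebra.
Variables (G : zmodType) (A : set G).

Lemma in_algebra_leq m m' X :
  (m <= m')%N -> in_algebra m A X -> in_algebra m' A X.
Proof. by move=> mm' [h hm AX]; exists h => //; exact: leq_trans mm'. Qed.

Lemma in_algebra_self : in_algebra 1 A A.
Proof.
exists [:: 0] => //; apply: sub_gen_smallest; exists 0; first exact: mem_head.
by rewrite translateE; apply/funext => x /=; rewrite subr0.
Qed.

Lemma in_algebraC m X : in_algebra m A X -> in_algebra m A (~` X).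
Proof.
move=> [h hm AX]; exists h => //.
by have [_ hC _ _] := boolean_algebra_generated [set translate g A | g in [set` h]]; exact: hC.
Qed.

Lemma in_algebraU m m' X Y :
  in_algebra m A X -> in_algebra m' A Y -> in_algebra (m + m') A (X `|` Y).
Proof.
move=> [h hm AX] [h' hm' AY]; exists (h ++ h'); first by rewrite size_cat leq_add.
have [_ _ + _] := boolean_algebra_generated [set translate g A | g in [set` h ++ h']].
apply.
  by move: AX; apply: generated_algebra_sub => _ [g gh <-];
    apply: sub_gen_smallest; exists g => //=; rewrite mem_cat gh.
by move: AY; apply: generated_algebra_sub => _ [g gh <-];
  apply: sub_gen_smallest; exists g => //=; rewrite mem_cat gh orbT.
Qed.

Lemma in_algebra_translate m g X :
  in_algebra m A X -> in_algebra m A (translate g X).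
Proof.
move=> [h hm AX]; exists [seq g + a | a <- h]; first by rewrite size_map.
move: AX; apply: generated_algebra_translate => _ [a ah <-].
by rewrite translateD; apply: sub_gen_smallest; exists (g + a) => //; exact: map_f.
Qed.

Lemma in_algebra_bigcup (T : eqType) (r : seq T) m (X : T -> set G) :
    (forall i, i \in r -> in_algebra m A (X i)) ->
  in_algebra (size r * m) A (\bigcup_(i in [set` r]) X i).
Proof.
elim: r => [_|i r IHr rX] /=.
  have [fT fC _ _] := boolean_algebra_generated [set translate g A | g in [set` [::]]].
  exists [::] => //.
  suff -> : \bigcup_(i in [set` [::]]) X i = ~` setT by exact: fC.
  by rewrite setCT; apply/seteqP; split=> // x [].
rewrite mulSn.
suff -> : \bigcup_(j in [set` i :: r]) X j = X i `|` \bigcup_(j in [set` r]) X j.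
  apply: in_algebraU; first by apply: rX; rewrite mem_head.
  by apply: IHr => j jr; apply: rX; rewrite inE jr orbT.
apply/seteqP; split=> [x [j /=]|x [Xi|[j jr Xj]]].
- by rewrite inE => /orP[/eqP->|jr] Xj; [left|right; exists j].
- by exists i => //=; rewrite mem_head.
- by exists j => //=; rewrite inE jr orbT.
Qed.

Lemma in_algebra_bigcap (T : eqType) (r : seq T) m (X : T -> set G) :
    (forall i, i \in r -> in_algebra m A (X i)) ->
  in_algebra (size r * m) A (\bigcap_(i in [set` r]) X i).
Proof.
move=> rX; rewrite -[X in in_algebra _ _ X]setCK setC_bigcap; apply: in_algebraC.
by apply: in_algebra_bigcup => i /rX; exact: in_algebraC.
Qed.

Lemma in_algebraD m m' X Y :
  in_algebra m A X -> in_algebra m' A Y -> in_algebra (m + m') A (X `\` Y).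
Proof.
move=> AX AY; rewrite -[_ `\` _]setCK; apply: in_algebraC.
by rewrite setCD; apply: in_algebraU => //; exact: in_algebraC.
Qed.

End InAlgebra.

Lemma in_algebra_trans (G : zmodType) m m' (A B X : set G) :
  in_algebra m A B -> in_algebra m' B X -> in_algebra (m' * m) A X.
Proof.
move=> [h hm AB] [h' hm' BX]; exists [seq a + b | a <- h', b <- h].
  by rewrite size_allpairs leq_mul.
move: BX; apply: generated_algebra_sub => _ [a ah' <-].
move: AB; apply: generated_algebra_translate => _ [b bh <-].
by rewrite translateD; apply: sub_gen_smallest; exists (a + b) => //; exact: allpairs_f.
Qed.

(** * The stabilizer of a union of cosets *)

Section Stabilizer.
Variables (G : zmodType) (q : nat) (S E : set G).
Hypotheses (sgS : subgroup S) (ES : invariant S E) (cE : covered q S E).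

(* Since E consists of finitely many cosets of S, E + g is contained in E only
   if it is equal to E. *)
Definition stabilizer : set G := [set g | forall x, E x -> E (x + g)].

Lemma stabilizer_sub : S `<=` stabilizer.
Proof. by move=> s Ss x Ex; exact: ES. Qed.

(** The difficulty is closure under opposites. Among the [x + h *+ i] with [i <= q], two lie in the
    same coset of [S], so a positive multiple of [h] lies in [S]. *)
Lemma stabilizer_subgroup : subgroup stabilizer.
Proof.
have H0 : stabilizer 0 by move=> x; rewrite addr0.
have HD g h : stabilizer g -> stabilizer h -> stabilizer (g + h).
  by move=> Hg Hh x Ex; rewrite addrA; apply/Hh/Hg.
have HM g n : stabilizer g -> stabilizer (g *+ n).
  by move=> Hg; elim: n => [|n IHn]; rewrite ?mulr0n ?mulrS //; exact: HD.
apply/subgroupP; split=> // g h Hg Hh; apply: HD => // {g Hg} x Ex.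
have [c cq cX] := cE.
have /choice[f fP] : forall i : 'I_q.+1, exists y, y \in c /\ S (x + h *+ i - y).
  by move=> i; have [y yc Sy] := cX _ (HM h i Hh x Ex); exists y.
have [finj|] := boolP (injectiveb f).
  have : (size (map f (enum 'I_q.+1)) <= size c)%N.
    apply: uniq_leq_size; first by rewrite map_inj_uniq ?enum_uniq //; exact/injectiveP.
    by move=> _ /mapP[i _ ->]; have [] := fP i.
  by rewrite size_map size_enum_ord => /(fun h => leq_trans h cq); rewrite ltnn.
(* With [n = j - i], the point [x + h *+ (n - 1)] is in [E] and [h *+ n] is in [S]; their difference
   is [x - h]. *)
have key (i j : nat) y : (i < j)%N -> S (x + h *+ i - y) -> S (x + h *+ j - y) ->
    E (x - h).
  move=> ij Si Sj; have := subgroup_diff sgS Si Sj.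
  rewrite opprD addrACA subrr add0r -[h *+ i - _]opprB -(mulrnBr _ (ltnW ij)).
  have -> : (j - i)%N = (j - i).-1.+1 by rewrite prednK // subn_gt0.
  move=> Sji; have := ES (HM h (j - i).-1 Hh x Ex) Sji.
  by rewrite mulrS opprD addrA addrAC addrK.
move=> /injectivePn[i [j ij fij]]; have [_ Si] := fP i; have [_] := fP j.
rewrite -fij => Sj; move: ij; rewrite neq_ltn => /orP[ij|ji].
  exact: key ij Si Sj.
exact: key ji Sj Si.
Qed.

(** By invariance under [S], it suffices to test [g] on one representative [e] in [E] of each coset;
    the test says that [g] lies in [E - e]. *)
Lemma stabilizer_in_algebra m A :
  in_algebra m A E -> in_algebra (q * m) A stabilizer.
Proof.
move=> AE; have [s [sq sE cs]] := covered_in sgS cE.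
suff -> : stabilizer = \bigcap_(e in [set` s]) translate (- e) E.
  apply: (@in_algebra_leq _ _ (size s * m)); first by rewrite leq_mul.
  by apply: in_algebra_bigcap => e _; exact: in_algebra_translate.
apply/seteqP; split=> [g Hg e es|g gE x Ex].
  by rewrite translateE /= opprK addrC; apply/Hg/sE.
have [e es Se] := cs x Ex; have := gE e es; rewrite translateE /= opprK => Ege.
by have := ES Ege Se; rewrite addrA addrAC addrK addrC.
Qed.

End Stabilizer.

(** * Unions of cosets that agree with a set up to a small error *)

Lemma covered_translate (G : zmodType) q (U X : set G) g :
  covered q U X -> covered q U (translate g X).
Proof.
move=> [s sq cX]; exists [seq g + c | c <- s]; first by rewrite size_map.
move=> _ [x Xx <-]; have [c cs Uc] := cX x Xx; exists (g + c); first exact: map_f.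
by rewrite opprD addrACA subrr add0r.
Qed.

Lemma in_algebra_bigcupT (G : zmodType) (A : set G) (I : finType) m (X : I -> set G) :
  (forall i, in_algebra m A (X i)) -> in_algebra (#|I| * m) A (\bigcup_i X i).
Proof.
move=> AX; rewrite cardE.
suff -> : \bigcup_i X i = \bigcup_(i in [set` enum I]) X i.
  by apply: in_algebra_bigcup.
by congr bigcup; apply/seteqP; split=> // i _ /=; rewrite mem_enum.
Qed.

Lemma in_algebra_bigcapT (G : zmodType) (A : set G) (I : finType) m (X : I -> set G) :
  (forall i, in_algebra m A (X i)) -> in_algebra (#|I| * m) A (\bigcap_i X i).
Proof.
move=> AX; rewrite -[X in in_algebra _ _ X]setCK setC_bigcap; apply: in_algebraC.
by apply: in_algebra_bigcupT => i; exact: in_algebraC.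
Qed.

(* Some L d + 1 translates of A by elements of S cover E, the union X of these
   is E up to a small set, and E is the intersection of sufficiently many
   translates of X by elements of S. *)
Lemma generic_in_algebra d L : exists K m, forall (G : zmodType) (S E A Z W : set G) Rs,
    subgroup S -> large K S Rs -> (size Rs <= d)%N -> invariant S E ->
    covered L (family_union Rs) Z -> covered L (family_union Rs) W ->
    E `\` W `<=` A -> A `<=` E `|` Z ->
  in_algebra m A E.
Proof.
(* Among [t + 1] separated translations one escapes [W]. The excess of [X] over [E] takes
   [L' = (t + 1) * L] translates, so [u + 1] separated translations serve for it. *)
pose t := (L * d)%N; pose L' := (t.+1 * L)%N; pose u := (L' * d)%N.
have [K1 K1P] := large_not_covered d t.
have [K2 K2P] := large_not_covered d u.
exists (maxn K1 K2), (u.+1 * (t.+1 * 1))%N => G S E A Z W Rs sgS lR szR ES cZ cW EA AE.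
have sgR R : R \in Rs -> subgroup R by move=> /lR[].
have nc1 : ~ covered t (family_union Rs) S.
  by apply: K1P => //; apply: large_leq lR; rewrite leq_maxl.
have nc2 : ~ covered u (family_union Rs) S.
  by apply: K2P => //; apply: large_leq lR; rewrite leq_maxr.
have [s [sS sU]] := separated_seq nc1 (fun x => @family_unionN _ _ _ _ x lR).
have [r [rS rU]] := separated_seq nc2 (fun x => @family_unionN _ _ _ _ x lR).
have ESD x y : S y -> E x -> E (x + y) by move=> Sy Ex; exact: ES.
have ESB x y : S y -> E x -> E (x - y).
  by move=> Sy Ex; apply: ES => //; exact: subgroupN.
pose X := \bigcup_i translate (s i) A.
have EX : E `<=` X.
  move=> e Ee; have [|i nW] := escape sgR cW _ sU e; first by rewrite leq_mul.
  by exists i => //; rewrite translateE; apply: EA; split=> //; exact: ESB.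
have cXE : covered L' (family_union Rs) (X `\` E).
  have := @covered_bigcup _ _ [set: 'I_t.+1]%SET _ _ (fun i => translate (s i) Z)
    (fun i _ => covered_translate (s i) cZ).
  rewrite cardsT card_ord.
  apply: covered_leq => // x [[i _]]; rewrite translateE => Ax nE.
  exists i; first by rewrite /= inE.
  rewrite translateE; case: (AE _ Ax) => // Ex; case: nE.
  by rewrite -(subrK (s i) x); exact: ESD.
suff -> : E = \bigcap_j translate (r j) X.
  have AX : in_algebra (t.+1 * 1) A X.
    rewrite -{1}(card_ord t.+1); apply: in_algebra_bigcupT => i.
    by apply: in_algebra_translate; exact: in_algebra_self.
  rewrite -{1}(card_ord u.+1); apply: in_algebra_bigcapT => j.
  exact: in_algebra_translate.
apply/seteqP; split=> [x Ex j _|x xX].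
  by rewrite translateE; apply: EX; exact: ESB.
have [|j nXE] := escape sgR cXE _ rU x; first by rewrite leq_mul.
rewrite -(subrK (r j) x); apply: ESD => //; apply: contrapT => nE; apply: nXE.
by split=> //; have := xX j I; rewrite translateE.
Qed.

(** For [h] in the stabilizer and [e] in [E], a generic [s] in [S] puts [s + e] and [s + e + h] in
    [E] outside [W], hence in [A]; their difference is [h]. *)
Lemma generic_stabilizer d L : exists K, forall (G : zmodType) (S E A W : set G) q Rs,
    subgroup S -> large K S Rs -> (size Rs <= d)%N -> invariant S E -> covered q S E ->
    covered L (family_union Rs) W -> E `\` W `<=` A -> E !=set0 ->
  stabilizer E `<=` difference_set A.
Proof.
have [K KP] := large_not_covered d (L + L).
exists K => G S E A W q Rs sgS lR szR ES cE cW EA [e Ee] h Hh.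
have [s Ss nW] : exists2 s, S s & ~ (translate (- e) W `|` translate (- e - h) W) s.
  apply: contra_notP (KP _ _ _ sgS lR szR) => nS.
  apply: covered_leq (coveredU (covered_translate (- e) cW)
    (covered_translate (- e - h) cW)) => // s Ss.
  by apply: contrapT => ns; apply: nS; exists s.
move: nW => /not_orP[]; rewrite !translateE /= opprD !opprK => nW nWh.
have Es : E (s + e) by rewrite addrC; exact: ES.
exists (s + (e + h)); last exists (s + e); last by rewrite addrA [_ + h]addrC addrK.
  by apply: EA; split=> //; rewrite addrA; exact: Hh.
by apply: EA; split.
Qed.

Lemma generic_part d L : exists K m, forall (G : zmodType) (S E A Z W : set G) q Rs,
    subgroup S -> large K S Rs -> (size Rs <= d)%N -> invariant S E -> covered q S E ->
    covered L (family_union Rs) Z -> covered L (family_union Rs) W ->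
    E `\` W `<=` A -> A `<=` E `|` Z ->
  in_algebra m A E /\ (E !=set0 -> stabilizer E `<=` difference_set A).
Proof.
have [K1 [m mP]] := generic_in_algebra d L.
have [K2 K2P] := generic_stabilizer d L.
exists (maxn K1 K2), m => G S E A Z W q Rs sgS lR szR ES cE cZ cW EA AE; split.
  by apply: mP sgS _ szR ES cZ cW EA AE; apply: large_leq lR; rewrite leq_maxl.
by apply: K2P sgS _ szR ES cE cW EA; apply: large_leq lR; rewrite leq_maxr.
Qed.

(** * Choosing a subgroup that is not virtually contained in another *)

Section Sink.
Variables (G : zmodType) (V : finType) (I : {set V}) (K : nat) (S : V -> set G).

Lemma covered_iter (f : V -> V) n v :
    (forall i, i \in I -> covered K (S (f i)) (S i)) ->
    (forall i, i \in I -> f i \in I) -> v \in I ->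
  covered (K ^ n) (S (iter n f v)) (S v).
Proof.
move=> fK fI vI; elim: n => [|n IHn]; first exact: covered_self.
rewrite expnSr; apply: covered_trans IHn _; apply: fK.
by elim: n => //= n; exact: fI.
Qed.

(* Without a sink, following virtual containments S i <= S (f i) leads to a cycle
   of length at most #|I|, along which the indices multiply. *)
Lemma exists_sink :
    (0 < K)%N -> (0 < #|I|)%N ->
    (forall i j, i \in I -> j \in I -> i != j ->
      covered (K ^ #|I|.+1) (S j) (S i) -> ~ covered (K ^ #|I|.+1) (S i) (S j)) ->
  exists2 i, i \in I & forall j, j \in I -> i != j -> ~ covered K (S j) (S i).
Proof.
move=> K0 /card_gt0P[v vI] nIS; apply: contrapT => nsink.
have /choice[f fP] : forall i, exists j, i \in I ->
    [/\ j \in I, i != j & covered K (S j) (S i)].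
  move=> i; apply: contrapT => /forallNP nj; apply: nsink; exists i.
    by apply: contrapT => iI; apply: (nj i).
  by move=> j jI ij cij; apply: (nj j).
have fI i : i \in I -> f i \in I by move=> /fP[].
have fK i : i \in I -> covered K (S (f i)) (S i) by move=> /fP[].
have itI n : iter n f v \in I by elim: n => //= n; exact: fI.
(* A repetition closes a cycle at [x]. One step leads to [f x] with index at most [K], and the other
   [b - a - 1] steps lead back, against the hypothesis on [x] and [f x]. *)
have key (a b : nat) : (a < b)%N -> (b <= #|I|)%N -> iter a f v <> iter b f v.
  move=> ab bI eab; set x := iter a f v in eab.
  have xI : x \in I by exact: itI.
  have [fxI xfx cx] := fP x xI; apply: (nIS _ _ xI fxI xfx).
    by apply: covered_leq cx => //; rewrite -[X in (X <= _)%N]expn1 leq_pexp2l.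
  have := covered_iter (b - a.+1) fK fI fxI.
  rewrite -iterSr -subSn // subSS /x -iterD subnK ?(ltnW ab) // -eab.
  apply: covered_leq => //; rewrite leq_pexp2l // leq_subLR.
  exact: leq_trans bI (leq_trans (leqnSn _) (leq_addl _ _)).
have /injectivePn[i [j ij eij]] : ~~ injectiveb (fun i : 'I_#|I|.+1 => iter i f v).
  apply/injectiveP => finj.
  have : (size (map (fun i : 'I_#|I|.+1 => iter i f v) (enum 'I_#|I|.+1)) <= size (enum I))%N.
    apply: uniq_leq_size; first by rewrite map_inj_uniq ?enum_uniq.
    by move=> _ /mapP[i _ ->]; rewrite mem_enum.
  by rewrite size_map size_enum_ord -cardE ltnn.
move: ij; rewrite neq_ltn => /orP[ij|ji].
  by apply: (key i j) => //; rewrite -ltnS.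
by apply: (key j i) => //; rewrite -ltnS.
Qed.

End Sink.

(** * Covers by cosets of subgroups in the generated algebra *)

Definition coset_cover (n m : nat) (G : zmodType) (A : set G) :=
  exists s : seq (G * set G), [/\ (size s <= n)%N,
    forall p, p \in s ->
      [/\ subgroup p.2, p.2 `<=` difference_set A & in_algebra m A p.2] &
    forall x, A x -> exists2 p, p \in s & p.2 (x - p.1)].

Lemma coset_cover_leq n n' m m' (G : zmodType) (A : set G) :
  (n <= n')%N -> (m <= m')%N -> coset_cover n m A -> coset_cover n' m' A.
Proof.
move=> nn' mm' [s [sn sP As]]; exists s; split=> //; first exact: leq_trans nn'.
by move=> p /sP[sgp pA Ap]; split=> //; exact: in_algebra_leq Ap.
Qed.

Lemma coset_cover0 n m (G : zmodType) : coset_cover n m (@set0 G).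
Proof. by exists [::]; split. Qed.

(** The set [A] without [E] takes [mE + 1] translates of [A], so [m] translates of it take
    [m * mE.+1]; its differences are differences of [A]. *)
Lemma coset_cover_setD n m q mE mH (G : zmodType) (A E H : set G) :
    subgroup H -> H `<=` difference_set A -> covered q H E ->
    in_algebra mE A E -> in_algebra mH A H -> coset_cover n m (A `\` E) ->
  coset_cover (q + n) (maxn mH (m * mE.+1)) A.
Proof.
move=> sgH HA [c cq cE] AE AH [s [sn sP As]].
exists ([seq (a, H) | a <- c] ++ s); split.
- by rewrite size_cat size_map leq_add.
- move=> p; rewrite mem_cat => /orP[/mapP[a _ ->]|/sP[sgp pA Ap]].
    by split=> //; apply: in_algebra_leq AH; rewrite leq_maxl.
  split=> //.
    by move=> x /pA[y [Ay _] [z [Az _] <-]]; exists y => //; exists z.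
  apply: in_algebra_leq (in_algebra_trans (in_algebraD (in_algebra_self A) AE) Ap).
  by rewrite add1n leq_maxr.
move=> x Ax; case: (pselect (E x)) => [/cE[a ac Ha]|nE].
  by exists (a, H) => //; rewrite mem_cat map_f.
by have [//|p ps px] := As x; exists p => //; rewrite mem_cat ps orbT.
Qed.

(** * Presentations by cosets: refining, merging and removing parts *)

Definition coset_union (G : zmodType) q (S P : set G) :=
  [/\ subgroup S, invariant S P & covered q S P].

Lemma coset_union_leq (G : zmodType) q q' (S P : set G) :
  (q <= q')%N -> coset_union q S P -> coset_union q' S P.
Proof. by move=> qq' [sgS SP cP]; split=> //; exact: covered_leq cP. Qed.

Lemma coset_unionI (G : zmodType) q K (S T P : set G) :
    subgroup T -> covered K T S -> coset_union q S P ->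
  coset_union (q * K) (S `&` T) P.
Proof.
move=> sgT cS [sgS SP cP]; split; first exact: subgroupI.
  by move=> x s Px [Ss _]; exact: SP.
apply: covered_trans cP _.
have := coveredI sgS sgT (covered_self S) cS.
by rewrite setIid mul1n.
Qed.

Lemma coset_unionU (G : zmodType) q q' (S P P' : set G) :
  coset_union q S P -> coset_union q' S P' -> coset_union (q + q') S (P `|` P').
Proof.
move=> [sgS SP cP] [_ SP' cP']; split=> //; last exact: coveredU.
by move=> x s [Px|Px] Ss; [left; exact: SP|right; exact: SP'].
Qed.

(** Positive parts are indexed by a subset of [V], which shrinks; negative parts by a whole type,
    which grows through [option]. *)
Record presentation (G : zmodType) (V J : finType) (q : nat) (A : set G)
    (I : {set V}) (S P : V -> set G) (T Q : J -> set G) : Prop := {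
  positive_part : forall v, v \in I -> coset_union q (S v) (P v);
  negative_part : forall j, coset_union q (T j) (Q j);
  presentationE : A = (\bigcup_(v in [set` I]) P v) `\` (\bigcup_j Q j) }.

Definition not_below (G : zmodType) (V J : finType) (I : {set V})
    (S : V -> set G) (T : J -> set G) : {set V * J} :=
  [set x | (x.1 \in I) && ~~ `[<S x.1 `<=` T x.2>]].

Section Presentation.
Variables (G : zmodType) (V J : finType) (q : nat) (A : set G) (I : {set V}).
Variables (S P : V -> set G) (T Q : J -> set G).
Hypothesis presA : presentation q A I S P T Q.

Lemma presentation_refine i j K :
    i \in I -> (0 < K)%N -> covered K (T j) (S i) ->
  presentation (q * K) A I [eta S with i |-> S i `&` T j] P T Q.
Proof.
move=> iI K0 cS; have [posA negA AE] := presA.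
have qK : (q <= q * K)%N by rewrite leq_pmulr.
split=> // [v vI /=|k]; last exact: coset_union_leq (negA k).
case: (v =P i) => [->|_]; last exact: coset_union_leq (posA v vI).
by apply: coset_unionI (posA i iI) => //; have [] := negA j.
Qed.

(** The pair [(i, j)] leaves the set, and none enters since [S i] only shrinks. *)
Lemma card_not_below_refine i j :
    i \in I -> ~ S i `<=` T j ->
  (#|not_below I [eta S with i |-> S i `&` T j] T| < #|not_below I S T|)%N.
Proof.
move=> iI nST; apply: proper_card; apply/properP; split; last first.
  exists (i, j); rewrite !inE /= iI /=; first exact/asboolPn.
  by rewrite eqxx negbK; apply/asboolP => x [].
apply/fintype.subsetP => -[v k]; rewrite !inE /= => /andP[-> /=].
case: (v =P i) => [->|//] /asboolPn nSTk; apply/asboolPn; apply: contra_not nSTk.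
by move=> STk x [/STk].
Qed.

(** The intersection of [S i] and [S j] has index at most [K] in both, so each of [P i] and [P j]
    consists of at most [q * K] of its cosets. *)
Lemma presentation_merge i j K :
    i \in I -> j \in I -> i != j -> (0 < K)%N ->
    covered K (S j) (S i) -> covered K (S i) (S j) ->
  presentation (q * K + q * K) A (I :\ j)
    [eta S with i |-> S i `&` S j] [eta P with i |-> P i `|` P j] T Q.
Proof.
move=> iI jI ij K0 cij cji; have [posA negA AE] := presA.
have qK : (q <= q * K + q * K)%N by rewrite (leq_trans _ (leq_addr _ _)) ?leq_pmulr.
have sgS v : v \in I -> subgroup (S v) by move=> /posA[].
split=> [v|k|].
- rewrite !inE => /andP[vj vI] /=; case: (v =P i) => _.
    apply: coset_unionU; first by apply: coset_unionI (posA i iI) => //; exact: sgS.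
    by rewrite setIC; apply: coset_unionI (posA j jI) => //; exact: sgS.
  exact: coset_union_leq (posA v vI).
- exact: coset_union_leq (negA k).
rewrite AE; congr (_ `\` _); apply/seteqP; split=> x [v /= vI].
  have [->|vi] := eqVneq v i; first by exists i; rewrite /= ?inE ?ij ?eqxx //; left.
  have [-> Px|vj Px] := eqVneq v j.
    by exists i; rewrite /= ?inE ?ij ?eqxx //; right.
  by exists v; rewrite /= ?inE ?vj // (negbTE vi).
move: vI; rewrite !inE => /andP[vj vI]; case: (v =P i) => [_ [Px|Px]|_ Px].
- by exists i.
- by exists j.
- by exists v.
Qed.

(** The removed [Q j] are those known to be invariant under [S i]; the others are treated as an
    error. *)
Definition main_part i : set G :=
  P i `\` \bigcup_(j in [set j | S i `<=` T j]) Q j.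

Lemma main_part_invariant i : i \in I -> invariant (S i) (main_part i).
Proof.
move=> iI; have [posA negA _] := presA.
have [sgS SP _] := posA i iI.
move=> x s [Px nQ] Ss; split; first exact: SP.
apply: contra_not nQ => -[j STj Qj]; exists j => //.
have [_ TQ _] := negA j; rewrite -(addrK s x); apply: TQ => //.
by apply: STj; exact: subgroupN.
Qed.

Lemma main_part_covered i : i \in I -> covered q (S i) (main_part i).
Proof.
move=> iI; have [posA _ _] := presA; have [_ _ cP] := posA i iI.
by apply: covered_leq cP => // x [].
Qed.

Lemma main_part_sub i : i \in I ->
  main_part i `\` (\bigcup_(j in [set` [set j | ~~ `[<S i `<=` T j>]]%SET]) Q j) `<=` A.
Proof.
move=> iI x [[Px nQ] nQ']; have [_ _ ->] := presA; split; first by exists i.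
move=> [j _ Qj]; case: (pselect (S i `<=` T j)) => STj.
  by apply: nQ; exists j.
by apply: nQ'; exists j => //=; rewrite inE; exact/asboolPn.
Qed.

Lemma sub_main_part i :
  A `<=` main_part i `|` \bigcup_(v in [set` I :\ i]) P v.
Proof.
have [_ _ ->] := presA => x [[v vI Px] nQ].
have [vi|vi] := eqVneq v i; last by right; exists v => //=; rewrite !inE vi.
left; rewrite -vi; split=> // -[j _ Qj]; apply: nQ; exists j => //.
Qed.

(** Outside its main part, [P i] lies in sets [Q j], so the index [i] disappears; the main part
    becomes the negative part at [None]. *)
Lemma presentation_setD i : i \in I ->
  presentation q (A `\` main_part i) (I :\ i) S P
    (fun o => if o is Some j then T j else S i)
    (fun o => if o is Some j then Q j else main_part i).
Proof.
move=> iI; have [posA negA AE] := presA.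
split=> [v|[j|]|].
- by rewrite !inE => /andP[_ /posA].
- exact: negA.
- split; [by have [] := posA i iI|exact: main_part_invariant|exact: main_part_covered].
apply/seteqP; split=> x.
  move=> [Ax nE]; have [//|Px] := sub_main_part i Ax; split=> // -[[j|] _ //].
  by move: Ax; rewrite AE => -[_ nQ] Qj; apply: nQ; exists j.
move=> [[v /=]]; rewrite !inE => /andP[vi vI] Px nQ; split.
  rewrite AE; split; first by exists v.
  by move=> [j _ Qj]; apply: nQ; exists (Some j).
by move=> Ex; apply: nQ; exists None.
Qed.

End Presentation.

(** * The induction on presentations *)

Lemma main_part_cover p q M : exists K m, forall (G : zmodType) (V J : finType)
    (A : set G) (I : {set V}) (S P : V -> set G) (T Q : J -> set G) i,
    presentation q A I S P T Q -> (#|I| <= p)%N -> (#|J| <= M)%N -> i \in I ->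
    (forall v, v \in I -> i != v -> ~ covered K (S v) (S i)) ->
    (forall j, ~ S i `<=` T j -> ~ covered K (T j) (S i)) ->
  forall n m', coset_cover n m' (A `\` main_part S P T Q i) ->
    coset_cover (q + n) (maxn (q * m) (m' * m.+1)) A.
Proof.
(* At most [p] other subgroups [S v] and at most [M] subgroups [T j] enter the error, each with at
   most [q] cosets. *)
have [K [m mP]] := generic_part (p + M) ((p + M) * q); exists K, m.
move=> G V J A I S P T Q i presA Ip JM iI nS nT n m'.
pose E := main_part S P T Q i; rewrite -/E => AE.
have [posA negA _] := presA.
have [sgS _ _] := posA i iI.
have invE : invariant (S i) E by exact: (main_part_invariant presA iI).
have cE : covered q (S i) E by exact: (main_part_covered presA iI).
pose J' : {set J} := [set j | ~~ `[<S i `<=` T j>]]%SET.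
pose Rs := [seq S v | v <- enum (I :\ i)] ++ [seq T j | j <- enum J'].
have lR : large K (S i) Rs.
  move=> R; rewrite mem_cat => /orP[] /mapP[].
    move=> v; rewrite mem_enum !inE => /andP[vi vI] ->; split.
      by have [] := posA v vI.
    by apply: nS; rewrite // eq_sym.
  move=> j; rewrite mem_enum inE => /asboolPn STj ->; split; last exact: nT.
  by have [] := negA j.
have Ip' : (#|I :\ i| <= p)%N by rewrite (leq_trans _ Ip) ?subset_leq_card ?subsetDl.
have JM' : (#|J'| <= M)%N by rewrite (leq_trans _ JM) ?max_card.
have szR : (size Rs <= p + M)%N by rewrite size_cat !size_map -!cardE leq_add.
have cZ : covered ((p + M) * q) (family_union Rs) (\bigcup_(v in [set` I :\ i]) P v).
  have : covered (#|I :\ i| * q) (family_union Rs) (\bigcup_(v in [set` I :\ i]) P v).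
    apply: covered_bigcup => v vI; have [_ _] := posA v (fintype.subsetP (subsetDl _ _) _ vI).
    apply: covered_leq => // x Sx; exists (S v) => //.
    by rewrite mem_cat map_f // mem_enum.
  by apply: covered_leq; rewrite // leq_mul // (leq_trans Ip') // leq_addr.
have cW : covered ((p + M) * q) (family_union Rs) (\bigcup_(j in [set` J']) Q j).
  have : covered (#|J'| * q) (family_union Rs) (\bigcup_(j in [set` J']) Q j).
    apply: covered_bigcup => j jJ; have [_ _] := negA j.
    apply: covered_leq => // x Tx; exists (T j) => //.
    by rewrite mem_cat orbC map_f // mem_enum.
  by apply: covered_leq; rewrite // leq_mul // (leq_trans JM') // leq_addl.
have [Em EA] := mP _ _ _ _ _ _ _ _ sgS lR szR invE cE cZ cW
  (main_part_sub presA iI) (sub_main_part presA i).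
(* An empty main part is skipped: its stabilizer would be all of [G]. *)
have [E0|/set0P/EA HA] := eqVneq E set0.
  rewrite E0 setD0 in AE; apply: coset_cover_leq AE; first by rewrite leq_addl.
  by rewrite (leq_trans _ (leq_maxr _ _)) // leq_pmulr.
apply: (coset_cover_setD _ HA _ Em _ AE).
- exact: (stabilizer_subgroup sgS invE cE).
- by apply: covered_leq cE => //; exact: stabilizer_sub.
- exact: (stabilizer_in_algebra sgS invE cE Em).
Qed.

Lemma card_not_below (G : zmodType) (V J : finType) (I : {set V})
    (S : V -> set G) (T : J -> set G) : (#|not_below I S T| <= #|I| * #|J|)%N.
Proof.
rewrite -[#|J|]cardsT -cardsX; apply/subset_leq_card/fintype.subsetP => -[v j].
by rewrite !inE andbT => /andP[].
Qed.

Lemma coset_cover_no_positive (G : zmodType) (V J : finType) (A : set G)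
    (I : {set V}) (S P : V -> set G) (T Q : J -> set G) q n m :
  presentation q A I S P T Q -> #|I| = 0%N -> coset_cover n m A.
Proof.
move=> [_ _ AE] I0; suff -> : A = set0 by exact: coset_cover0.
by rewrite AE; apply/seteqP; split=> x // [[v /=]]; rewrite (card0_eq I0).
Qed.

(* Induction on the number of subgroups S v, then on the number of pairs with
   S v not contained in T j. *)
Lemma presentation_cover p b q M : exists n m, forall (G : zmodType) (V J : finType)
    (A : set G) (I : {set V}) (S P : V -> set G) (T Q : J -> set G),
    presentation q A I S P T Q ->
    (#|I| <= p)%N -> (#|not_below I S T| < b)%N -> (#|J| <= M)%N ->
  coset_cover n m A.
Proof.
elim: p b q M => [|p IHp] b q M.
  exists 0%N, 0%N => G V J A I S P T Q presA.
  by rewrite leqn0 => /eqP I0 _ _; exact: coset_cover_no_positive presA I0.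
elim: b q => [|b IHb] q; first by exists 0%N, 0%N.
have [K0 [mE EP]] := main_part_cover p.+1 q M.
(* The exponent [p + 2] is what the search for a sink requires for at most [p + 1] indices. *)
pose K := maxn K0 1; pose K' := (K ^ p.+2)%N.
have K_gt0 : (0 < K)%N by rewrite leq_maxr.
have K'_gt0 : (0 < K')%N by rewrite expn_gt0 K_gt0.
(* The three bounds serve a refinement, a merging and the removal of a main part. The first lowers
   [b]; the others lower [p] and restart [b] above the largest possible number of pairs. The removal
   adds a negative part, hence [M.+1]. *)
have [n1 [m1 cover1]] := IHb (q * K)%N.
have [n2 [m2 cover2]] := IHp (p * M).+1 (q * K' + q * K')%N M.
have [n3 [m3 cover3]] := IHp (p * M.+1).+1 q M.+1.
exists (n1 + n2 + (q + n3))%N, (m1 + m2 + maxn (q * mE) (m3 * mE.+1))%N.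
move=> G V J A I S P T Q presA Ip bb JM.
have [I0|I_gt0] := posnP #|I|; first exact: coset_cover_no_positive presA I0.
case: (pselect (exists i j, [/\ i \in I, ~ S i `<=` T j & covered K (T j) (S i)])).
  move=> [i [j [iI nST cS]]].
  apply: coset_cover_leq (cover1 _ _ _ _ _ _ _ _ _ (presentation_refine presA iI K_gt0 cS) Ip _ JM).
  - by rewrite -addnA leq_addr.
  - by rewrite -addnA leq_addr.
  by rewrite -ltnS (leq_trans _ bb) // ltnS card_not_below_refine.
move=> /forallNP nT.
case: (pselect (exists i j, [/\ i \in I, j \in I, i != j &
    covered K' (S j) (S i) /\ covered K' (S i) (S j)])).
  move=> [i [j [iI jI ij [cij cji]]]].
  have Ij : (#|I :\ j| <= p)%N.
    by move: Ip; rewrite (cardsD1 j) jI.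
  apply: coset_cover_leq (cover2 _ _ _ _ _ _ _ _ _
    (presentation_merge presA iI jI ij K'_gt0 cij cji) Ij _ JM).
  - by rewrite addnAC leq_addl.
  - by rewrite addnAC leq_addl.
  by rewrite ltnS (leq_trans (card_not_below _ _ _)) // leq_mul.
move=> /forallNP nS.
(* No refinement and no merging is possible, so a sink [i] exists, and its main part can be split
   off. *)
have [|i iI iS] := @exists_sink G V I K S K_gt0 I_gt0.
  move=> i j iI jI ij cij cji; apply: (nS i); exists j; split=> //.
  have KK : (K ^ #|I|.+1 <= K')%N by rewrite leq_pexp2l.
  by split; [apply: covered_leq cij|apply: covered_leq cji].
have Ii : (#|I :\ i| <= p)%N by move: Ip; rewrite (cardsD1 i) iI.
have K0K : (K0 <= K)%N by rewrite leq_maxl.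
apply: coset_cover_leq (EP _ _ _ _ _ _ _ _ _ _ presA Ip JM iI _ _ _ _
  (cover3 _ _ _ _ _ _ _ _ _ (presentation_setD presA iI) Ii _ _)).
- by rewrite leq_addl.
- by rewrite leq_addl.
- by move=> v vI iv; apply: contra_not (iS v vI iv); exact: covered_leq.
- move=> j STj cS; apply: (nT i); exists j; split=> //.
  exact: covered_leq cS.
- rewrite ltnS (leq_trans (card_not_below _ _ _)) // leq_mul // card_option ltnS //.
- by rewrite card_option ltnS.
Qed.

(** * Weakly normal sets as unions of cosets of their periods *)

Definition periods (G : zmodType) (B : set G) : set G := [set g | shift B g = B].

Lemma periodsP (G : zmodType) (B : set G) g :
  periods B g <-> forall x, B (x + g) <-> B x.
Proof.
split=> [Bg x|Bg]; first by rewrite -[in X in _ <-> X]Bg.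
by apply/seteqP; split=> x /Bg.
Qed.

Lemma periods_shift (G : zmodType) (B : set G) b b' :
  shift B b = shift B b' -> periods B (b - b').
Proof.
move=> bb'; apply/periodsP => x.
have /(congr1 (fun X : set G => X (x - b'))) := bb'.
by rewrite /shift /= subrK -addrA [- b' + b]addrC => ->.
Qed.

Lemma subgroup_periods (G : zmodType) (B : set G) : subgroup (periods B).
Proof.
apply/subgroupP; split; first by apply/periodsP => x; rewrite addr0.
move=> g h /periodsP Bg /periodsP Bh; apply/periodsP => x.
rewrite addrA; apply: iff_trans (Bg x).
by apply: iff_trans (iff_sym (Bh _)) _; rewrite subrK.
Qed.

(* The translates B - b with b in B all contain 0, and they are pairwise distinct
   when the b lie in distinct cosets of the periods: hence B consists of fewer
   than r such cosets. *)
Lemma weakly_normal_coset_union r (G : zmodType) (B : set G) :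
  weakly_normal r B -> coset_union r (periods B) B.
Proof.
move=> wB; split; first exact: subgroup_periods.
  by move=> x s Bx /periodsP ->.
case: r wB => [|r] wB.
  have : (\bigcap_(i in [set: 'I_0]) shift B (0 : G)) 0 by move=> [].
  by rewrite (wB (fun=> 0)) // => -[].
suff : covered r (periods B) B by exact: covered_leq.
apply: contrapT => /separated_seq[x Bx|s [sB sP]].
  by apply: subgroupN Bx; exact: subgroup_periods.
have : (\bigcap_i shift B (s i)) 0 by move=> i _; rewrite /shift /= add0r.
by rewrite wB // => i j ij /periods_shift; exact: sP.
Qed.

(** The union of the complements of the [C i] is the complement of their intersection, which
    consists of at most [r ^ l] cosets of the intersection of the groups of periods. Hence one
    negative part, indexed by [unit]. *)
Lemma weakly_normal_representation_presentation r k l (G : zmodType) (A : set G) :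
    weakly_normal_representation r k l A ->
  exists S P (T Q : unit -> set G), presentation (r + r ^ l) A [set: 'I_k]%SET S P T Q.
Proof.
move=> [B [C [wB wC ->]]].
exists (fun j => periods (B j)), B, (fun=> \bigcap_i periods (C i)), (fun=> \bigcap_i C i).
have uC i : coset_union r (periods (C i)) (C i) by exact: weakly_normal_coset_union.
split=> [v _|_|].
- by apply: coset_union_leq (weakly_normal_coset_union (wB v)); exact: leq_addr.
- apply: (coset_union_leq (leq_addl _ _)); split.
  + apply/subgroupP; split=> [i _|x y Tx Ty i _].
      exact: subgroup0 (subgroup_periods _).
    by apply: subgroupB (Tx i I) (Ty i I); exact: subgroup_periods.
  + by move=> x s Cx Ts i _; have [_ CS _] := uC i; exact: CS (Cx i I) (Ts i I).
  rewrite -[X in (_ ^ X)%N](card_ord l); apply: covered_bigcap => i.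
    exact: subgroup_periods.
  by have [_ _] := uC i.
apply/seteqP; split=> x.
  move=> [[j _ Bj] [i _ nC]]; split; first by exists j => //=; rewrite inE.
  by move=> [_ _ Cx]; apply: nC; exact: Cx.
move=> [[j _ Bj] nC]; split; first by exists j.
apply: contrapT => nC'; apply: nC; exists tt => // i _.
by apply: contrapT => Ci; apply: nC'; exists i.
Qed.

Lemma weakly_normal_representation_cover r k l : exists n m,
  forall (G : zmodType) (A : set G),
  weakly_normal_representation r k l A -> coset_cover n m A.
Proof.
have [n [m cover]] := presentation_cover k (k * 1).+1 (r + r ^ l) 1.
exists n, m => G A /weakly_normal_representation_presentation[S [P [T [Q presA]]]].
apply: cover presA _ _ _; rewrite ?card_unit ?cardsT ?card_ord //.
by rewrite ltnS (leq_trans (card_not_below _ _ _)) // cardsT card_ord card_unit.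
Qed.

(** * Pigeonhole counting, and families of exactly [n] cosets *)

Lemma pigeonhole_cover (T : choiceType) n (A : set T) (X : 'I_n -> set T) :
    finite_set A -> A !=set0 -> A `<=` \bigcup_i X i ->
  exists i, (#|` fset_set A| <= #|` fset_set (A `&` X i)| * n)%N.
Proof.
move=> finA [a Aa] AX; apply: contrapT => /forallNP nX.
have finAX i : finite_set (A `&` X i) by exact: finite_setIl.
have [i0 _ _] := AX a Aa.
have n_gt0 : (0 < n)%N by case: n i0 {AX nX finAX X} => [[]|].
pose F := [seq enum_fset (fset_set (A `&` X i)) | i <- enum 'I_n].
have : (#|` fset_set A| <= size (flatten F))%N.
  apply: uniq_leq_size; first exact: fset_uniq.
  move=> x; rewrite in_fset_set // inE => Ax; have [i _ Xi] := AX x Ax.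
  apply/flatten_mapP; exists i; first by rewrite mem_enum.
  by rewrite in_fset_set // inE.
rewrite size_flatten /shape -map_comp sumnE big_map big_enum /=.
(* By contradiction, [n] times the size of each intersection is below the size of [A]. Each strict
   inequality gains 1 in the sum, and [n > 0]. *)
rewrite leqNgt => /negP; apply; rewrite -(ltn_pmul2r n_gt0) big_distrl /=.
have : (\sum_(i < n) (#|` fset_set (A `&` X i)| * n).+1 <= \sum_(i < n) #|` fset_set A|)%N.
  by apply: leq_sum => i _; rewrite ltnNge; apply/negP.
rewrite sum_nat_const card_ord mulnC; apply: leq_trans.
under [X in (_ < X)%N]eq_bigr do rewrite -addn1.
by rewrite big_split /= sum_nat_const card_ord muln1 -addn1 leq_add2l.
Qed.

(** The list is padded to length [n] by repeating one of its members, and base points are moved into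
    [A]; for a coset that misses [A], any point of [A] will do. *)
Lemma coset_cover_family n m (G : zmodType) (A : set G) :
    coset_cover n m A -> A !=set0 ->
  exists (H : 'I_n -> set G) (g : 'I_n -> G),
    [/\ forall i, subgroup (H i) /\ H i `<=` difference_set A,
        forall i, A (g i),
        A `<=` \bigcup_(i in [set: 'I_n]) translate (g i) (H i) &
        forall i, exists h : 'I_m -> G,
          generated_algebra [set translate (h j) A | j in [set: 'I_m]] (H i)].
Proof.
move=> [s [sn sP As]] [a Aa]; have [p0 p0s _] := As a Aa.
pose p (i : 'I_n) := nth p0 s i.
have ps i : p i \in s by rewrite /p; case: (ltnP i (size s)) => si; [exact: mem_nth|rewrite nth_default].
have /choice[g gP] : forall i, exists g, A g /\
    ((exists x, A x /\ (p i).2 (x - (p i).1)) -> (p i).2 (g - (p i).1)).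
  move=> i; case: (pselect (exists x, A x /\ (p i).2 (x - (p i).1))).
    by move=> [x [Ax px]]; exists x.
  by exists a.
exists (fun i => (p i).2), g; split=> [i|i|x Ax|i].
- by have [] := sP _ (ps i).
- by have [] := gP i.
- have [q /(nthP p0)[j js jq] qx] := As x Ax.
  pose i := Ordinal (leq_trans js sn); have pi : p i = q by [].
  exists i => //; rewrite translateE /=; have [sgp _ _] := sP _ (ps i).
  have [_ gx] := gP i; apply: (subgroup_diff sgp (a := (p i).1)); first by rewrite pi.
  by apply: gx; exists x; rewrite pi.
(* Beyond the length of [h], the default value 0 adds [A] itself as a generator, which can only
   enlarge the algebra. *)
have [_ _ [h hm AH]] := sP _ (ps i); exists (fun j => h`_j).
move: AH; apply: generated_algebra_sub => _ [b bh <-].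
apply: sub_gen_smallest; have /(nthP 0)[j jh <-] := bh.
by exists (Ordinal (leq_trans jh hm)).
Qed.

(* For A empty no g could be chosen in A. *)
Theorem theoremB (r k l : nat) :
  exists n m : nat,
  forall (G : zmodType) (A : set G),
    weakly_normal_representation r k l A ->
    A !=set0 ->
    (exists (H : 'I_n -> set G) (g : 'I_n -> G),
      [/\ forall i, subgroup (H i) /\ H i `<=` difference_set A,
          forall i, A (g i),
          A `<=` \bigcup_(i in [set: 'I_n]) translate (g i) (H i) &
          forall i, exists h : 'I_m -> G,
            generated_algebra [set translate (h j) A | j in [set: 'I_m]] (H i)])
    /\
    (finite_set A ->
      exists (g : G) (H : set G),
        [/\ A g, subgroup H, H `<=` difference_set A &
            (#|` fset_set A|%:R / n%:R
               <= #|` fset_set (A `&` translate g H)|%:R :> rat)]).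
Proof.
have [n [m cover]] := weakly_normal_representation_cover r k l.
exists n, m => G A /cover cA A0.
split=> [|finA]; first exact: coset_cover_family.
have [H [g [HA gA AH _]]] := coset_cover_family cA A0.
have [i Ai] := pigeonhole_cover finA A0 AH.
have [sgH HiA] := HA i; exists (g i), (H i); split=> //.
rewrite ler_pdivrMr -?natrM ?ler_nat // ltr0n.
by case: n i {cover cA H g HA gA AH sgH HiA Ai} => [[]|].
Qed.
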